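(* Let $H\supseteq A$ be a Bäckström pair such that $A$ is left noetherian and $H$ is left hereditary and finitely generated as a left $A$-module. Let $\tilde A$ be the Auslander envelope of the pair, let $M$ be a left $H$-module and $M^+=\begin{pmatrix}M\\ M\end{pmatrix}$. Then: (1) $\mathrm{Hom}_{\tilde A}(\bar A,M^+)\simeq\mathrm{ann}_M C=\{u\in M\mid Cu=0\}$. (2) $\mathrm{Ext}^1_{\tilde A}(\bar A,M^+)\simeq\mathrm{Hom}_H(C,M)/(M/\mathrm{ann}_MC)$, where the quotient $M/\mathrm{ann}_MC$ embeds into $\mathrm{Hom}_H(C,M)$ by mapping (the class of) an element $u\in M$ to the homomorphism $\mu_u:c\mapsto cu$.
   Context: A Bäckström pair is a pair of semiperfect rings $H\supseteq A$ with $\mathrm{rad}\,A=\mathrm{rad}\,H$. The conductor is $C=\{\alpha\in A\mid H\alpha\subseteq A\}$, a two-sided $H$-ideal contained in $A$. The Auslander envelope is the matrix ring $\tilde A=\begin{pmatrix}A&H\\ C&H\end{pmatrix}$. Modules are left modules. $\bar A=A/C\simeq\tilde A\big/\begin{pmatrix}C&H\\ C&H\end{pmatrix}$, regarded as a left $\tilde A$-module (equivalently the column $\begin{pmatrix}A/C\\0\end{pmatrix}$). For an $H$-module $M$, $M^+$ is the $\tilde A$-module of columns with entries in $M$, with $\tilde A$ acting by matrix multiplication. *)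

(* Defs.v *)
From HB Require Import structures.
From mathcomp Require Import all_boot all_algebra.
From mathcomp Require Import boolp functions.

Set Implicit Arguments.
Unset Strict Implicit.
Unset Printing Implicit Defensive.

Import GRing.Theory.
Local Open Scope ring_scope.
Local Open Scope quotient_scope.

(** * Abelian groups *)

Definition zmod_iso (U V : zmodType) : Prop :=
  exists f : {additive U -> V}, bijective f.

Definition sub_zmod (V : zmodType) (S : zmodClosed V) : Type :=
  {x : V | x \in S}.

Section SubZmod.
Variables (V : zmodType) (S : zmodClosed V).
HB.instance Definition _ := SubChoice.on (sub_zmod S).
HB.instance Definition _ := [SubChoice_isSubZmodule of sub_zmod S by <:].
End SubZmod.

Definition additive_image (U V : zmodType) (f : {additive U -> V}) : {pred V} :=
  fun y => `[< exists x, f x = y >].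

Section AdditiveImage.
Variables (U V : zmodType) (f : {additive U -> V}).

Fact additive_image_zmod_closed : zmod_closed (additive_image f).
Proof.
split; first by apply/asboolP; exists 0; rewrite raddf0.
move=> _ _ /asboolP[x <-] /asboolP[y <-].
by apply/asboolP; exists (x - y); rewrite raddfB.
Qed.

HB.instance Definition _ :=
  GRing.isZmodClosed.Build V (additive_image f) additive_image_zmod_closed.
End AdditiveImage.

Definition coker (U V : zmodType) (f : {additive U -> V}) : zmodType :=
  Quotient.quot (additive_image f).

(** * The additive group of linear maps between two modules *)

Lemma linear_ext (R : pzRingType) (U V : lmodType R) (f g : {linear U -> V}) :
  f =1 g -> f = g.
Proof.
move: f g => [f [[[p p1]] [q]]] [g [[[p' p1']] [q']]] /= /funext fg.
move: p p1 q p' p1' q'; rewrite fg => p p1 q p' p1' q'.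
by rewrite (Prop_irrelevance p p') (Prop_irrelevance p1 p1')
  (Prop_irrelevance q q').
Qed.

Section LinearGroup.
Variables (R : pzRingType) (U V : lmodType R).
Implicit Types f g h : {linear U -> V}.

HB.instance Definition _ := gen_eqMixin {linear U -> V}.
HB.instance Definition _ := gen_choiceMixin {linear U -> V}.

Definition linear_zero : {linear U -> V} := \0.
Definition linear_opp f : {linear U -> V} := \- f.
Definition linear_add f g : {linear U -> V} := f \+ g.

Fact linear_addA : associative linear_add.
Proof. by move=> f g h; apply: linear_ext => x /=; rewrite addrA. Qed.
Fact linear_addC : commutative linear_add.
Proof. by move=> f g; apply: linear_ext => x /=; rewrite addrC. Qed.
Fact linear_add0 : left_id linear_zero linear_add.
Proof. by move=> f; apply: linear_ext => x /=; rewrite add0r. Qed.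
Fact linear_addN : left_inverse linear_zero linear_opp linear_add.
Proof. by move=> f; apply: linear_ext => x /=; rewrite addNr. Qed.

HB.instance Definition _ := GRing.isZmodule.Build {linear U -> V}
  linear_addA linear_addC linear_add0 linear_addN.

End LinearGroup.

(** * Submodules and quotient modules *)

Definition submod (R : pzRingType) (M : lmodType R) (S : submodClosed M) : Type :=
  {x : M | x \in S}.

Section Submod.
Variables (R : pzRingType) (M : lmodType R) (S : submodClosed M).

HB.instance Definition _ := SubChoice.on (submod S).
HB.instance Definition _ := [SubChoice_isSubLmodule of submod S by <:].

(* [S] again, carrying the [zmodClosed] structure that [Quotient.quot] expects *)
Definition submod_pred : {pred M} := fun x => x \in S.

Fact submod_pred_zmod_closed : zmod_closed submod_pred.
Proof.
case: (submodClosedP S) => S0 SD; split=> // x y Sx Sy.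
by rewrite unfold_in -scaleN1r addrC SD.
Qed.

HB.instance Definition _ :=
  GRing.isZmodClosed.Build M submod_pred submod_pred_zmod_closed.

Definition quot_mod : Type := Quotient.quot submod_pred.

HB.instance Definition _ := GRing.Zmodule.on quot_mod.
HB.instance Definition _ := EqQuotient.on quot_mod.

Definition quot_proj (x : M) : quot_mod := \pi x.

Lemma quot_projE x y : (quot_proj x == quot_proj y) = (x - y \in S).
Proof. by rewrite -[RHS]/(x - y \in submod_pred) Quotient.idealrBE. Qed.

Fact quot_proj_is_zmod_morphism : zmod_morphism quot_proj.
Proof. exact: (@pi_is_zmod_morphism M _ _ (Quotient.quot submod_pred)). Qed.

HB.instance Definition _ :=
  GRing.isZmodMorphism.Build M quot_mod quot_proj quot_proj_is_zmod_morphism.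

Definition quot_scale (a : R) (x : quot_mod) : quot_mod :=
  quot_proj (a *: repr x).

Lemma quot_scaleE a x : quot_scale a (quot_proj x) = quot_proj (a *: x).
Proof.
apply/eqP; rewrite quot_projE -scalerBr rpredZ // -quot_projE.
by rewrite /quot_proj reprK.
Qed.

Lemma quot_projP (x : quot_mod) : exists y, quot_proj y = x.
Proof. by exists (repr x); rewrite /quot_proj reprK. Qed.

Fact quot_scaleA a b x : quot_scale a (quot_scale b x) = quot_scale (a * b) x.
Proof. by case: (quot_projP x) => y <-; rewrite !quot_scaleE scalerA. Qed.
Fact quot_scale1 : left_id 1 quot_scale.
Proof. by move=> x; case: (quot_projP x) => y <-; rewrite quot_scaleE scale1r. Qed.
Fact quot_scaleDr : right_distributive quot_scale +%R.
Proof.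
move=> a x y; case: (quot_projP x) (quot_projP y) => x' <- [y' <-].
by rewrite !quot_scaleE -!(raddfD quot_proj) quot_scaleE scalerDr.
Qed.
Fact quot_scaleDl x : {morph quot_scale^~ x : a b / a + b}.
Proof.
by move=> a b; case: (quot_projP x) => y <-; rewrite !quot_scaleE scalerDl (raddfD quot_proj).
Qed.

HB.instance Definition _ := GRing.Zmodule_isLmodule.Build R quot_mod
  quot_scaleA quot_scale1 quot_scaleDr quot_scaleDl.

Fact quot_proj_is_scalable : scalable quot_proj.
Proof. by move=> a x; rewrite -quot_scaleE. Qed.

HB.instance Definition _ :=
  GRing.isScalable.Build R M quot_mod *:%R quot_proj quot_proj_is_scalable.

End Submod.

(** * Properties of modules and rings *)

Definition maximal_submod (R : pzRingType) (M : lmodType R)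
    (S : submodClosed M) : Prop :=
  (exists x, x \notin S) /\
  forall T : submodClosed M, {subset S <= T} -> T =i S \/ T =i predT.

Definition semisimple (R : pzRingType) (M : lmodType R) : Prop :=
  forall S : submodClosed M, exists T : submodClosed M,
    (forall x, x \in S -> x \in T -> x = 0) /\
    (forall x, exists s t, [/\ s \in S, t \in T & x = s + t]).

Definition noetherian (R : pzRingType) (M : lmodType R) : Prop :=
  forall S : nat -> submodClosed M,
    (forall n, {subset S n <= S n.+1}) ->
    exists n, forall m, (n <= m)%N -> S m =i S n.

Definition finitely_generated (R : pzRingType) (M : lmodType R) : Prop :=
  exists (n : nat) (g : 'I_n -> M),
    forall x, exists a : 'I_n -> R, x = \sum_i a i *: g i.

Definition projective (R : pzRingType) (P : lmodType R) : Prop :=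
  forall (M N : lmodType R) (p : {linear M -> N}) (f : {linear P -> N}),
    (forall y, exists x, p x = y) ->
    exists g : {linear P -> M}, forall x, p (g x) = f x.

Definition left_noetherian (R : pzRingType) : Prop := noetherian R^o.

Definition left_hereditary (R : pzRingType) : Prop :=
  forall I : submodClosed R^o, projective (submod I).

Section Jacobson.
Variable R : pzRingType.

Definition jacobson : {pred R^o} :=
  fun x => `[< forall I : submodClosed R^o, maximal_submod I -> x \in I >].

Fact jacobson_submod_closed : submod_closed jacobson.
Proof.
split; first by apply/asboolP => I _; rewrite rpred0.
move=> a x y /asboolP xJ /asboolP yJ; apply/asboolP => I Imax.
by rewrite rpredD ?rpredZ ?xJ ?yJ.
Qed.

HB.instance Definition _ :=
  GRing.isSubmodClosed.Build R R^o jacobson jacobson_submod_closed.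

End Jacobson.

Arguments jacobson R : clear implicits.

(* R / rad R is a semisimple (artinian) ring, i.e. a semisimple left module,
   and idempotents lift modulo rad R. *)
Definition semiperfect (R : pzRingType) : Prop :=
  semisimple (quot_mod (jacobson R)) /\
  forall x : R, x * x - x \in jacobson R ->
    exists e : R, e * e = e /\ e - x \in jacobson R.

(** * Subrings and restriction of scalars *)

Definition subring (R : pzRingType) (A : subringClosed R) : Type :=
  {x : R | x \in A}.

Section Subring.
Variables (R : pzRingType) (A : subringClosed R).
HB.instance Definition _ := SubChoice.on (subring A).
HB.instance Definition _ :=
  GRing.SubChoice_isSubPzRing.Build R (mem A) (subring A) (subringClosedP A).

Definition subring_val : {rmorphism subring A -> R} := val.
End Subring.

Definition restr_scalars (R S : pzRingType) (f : {rmorphism R -> S})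
  (M : lmodType S) : Type := M.

Section RestrScalars.
Variables (R S : pzRingType) (f : {rmorphism R -> S}) (M : lmodType S).

HB.instance Definition _ := GRing.Zmodule.on (restr_scalars f M).

Definition restr_scale (a : R) (x : restr_scalars f M) : restr_scalars f M :=
  f a *: (x : M).

Fact restr_scaleA a b x : restr_scale a (restr_scale b x) = restr_scale (a * b) x.
Proof. by rewrite /restr_scale scalerA rmorphM. Qed.
Fact restr_scale1 : left_id 1 restr_scale.
Proof. by move=> x; rewrite /restr_scale rmorph1 scale1r. Qed.
Fact restr_scaleDr : right_distributive restr_scale +%R.
Proof. by move=> a x y; rewrite /restr_scale scalerDr. Qed.
Fact restr_scaleDl x : {morph restr_scale^~ x : a b / a + b}.
Proof. by move=> a b; rewrite /restr_scale rmorphD scalerDl. Qed.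

HB.instance Definition _ := GRing.Zmodule_isLmodule.Build R (restr_scalars f M)
  restr_scaleA restr_scale1 restr_scaleDr restr_scaleDl.
End RestrScalars.

(** * Projective resolutions and Ext groups *)

Record proj_resolution (R : pzRingType) (N : lmodType R) := ProjResolution {
  res_obj : nat -> lmodType R;
  res_diff : forall n, {linear res_obj n.+1 -> res_obj n};
  res_aug : {linear res_obj 0%N -> N};
  res_projective : forall n, projective (res_obj n);
  res_aug_surj : forall y, exists x, res_aug x = y;
  res_exact0 : forall x, res_aug x = 0 <-> exists y, res_diff 0%N y = x;
  res_exactS : forall n x,
    res_diff n x = 0 <-> exists y, res_diff n.+1 y = x
}.

Section Ext.
Variables (R : pzRingType) (N : lmodType R) (P : proj_resolution N).
Variable (M : lmodType R).

Definition cocycle n : {pred {linear res_obj P n -> M}} :=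
  fun f => `[< forall x, f (res_diff P n x) = 0 >].

Fact cocycle_zmod_closed n : zmod_closed (@cocycle n).
Proof.
split; first exact/asboolP.
by move=> f g /asboolP Zf /asboolP Zg; apply/asboolP => x /=; rewrite Zf Zg subrr.
Qed.

HB.instance Definition _ n :=
  GRing.isZmodClosed.Build _ (@cocycle n) (cocycle_zmod_closed n).

Definition coboundary n : {pred sub_zmod (@cocycle n)} :=
  match n with
  | 0%N => fun f => f == 0
  | k.+1 => fun f => `[< exists g : {linear res_obj P k -> M},
                           forall x, val f x = g (res_diff P k x) >]
  end.

Fact coboundary_zmod_closed n : zmod_closed (@coboundary n).
Proof.
case: n => [|n].
  by split=> [|f g /eqP-> /eqP->]; rewrite unfold_in /= ?subrr.
split; first by apply/asboolP; exists 0.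
move=> f g /asboolP[f' fE] /asboolP[g' gE]; apply/asboolP.
by exists (f' - g') => x /=; rewrite fE gE.
Qed.

HB.instance Definition _ n :=
  GRing.isZmodClosed.Build _ (@coboundary n) (coboundary_zmod_closed n).

(* [Ext_res n] is the [n]-th cohomology group of the complex of linear maps
   from the resolution [P] of [N] to [M]: it is Ext^n(N, M) computed with [P]. *)
Definition Ext_res n : zmodType := Quotient.quot (@coboundary n).

End Ext.

(** * Existence of projective resolutions, by free modules *)

Section FreeModule.
Variables (R : pzRingType) (N : lmodType R).

Definition fin_supp : {pred N -> R^o} :=
  fun f => `[< exists s : seq N, forall x, x \notin s -> f x = 0 >].

Fact fin_supp_submod_closed : submod_closed fin_supp.
Proof.
split; first by apply/asboolP; exists [::].
move=> a f g /asboolP[s fs] /asboolP[t gt]; apply/asboolP; exists (s ++ t) => x.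
rewrite mem_cat negb_or => /andP[xs xt].
by rewrite -[LHS]/(a * f x + g x) fs // gt // mulr0 addr0.
Qed.

HB.instance Definition _ :=
  GRing.isSubmodClosed.Build R (N -> R^o) fin_supp fin_supp_submod_closed.

(* The free module on the underlying set of [N] *)
Definition free_mod : lmodType R := submod fin_supp.

Definition coef (f : free_mod) (x : N) : R := val f x.

Lemma fin_suppP (f : free_mod) :
  exists s : seq N, forall x, x \notin s -> coef f x = 0.
Proof. exact/asboolP/(valP f). Qed.

Section Lift.
Variables (M : lmodType R) (phi : N -> M).

Definition free_lift (f : free_mod) : M :=
  \sum_(x <- undup (projT1 (cid (fin_suppP f)))) coef f x *: phi x.

Lemma free_liftE (f : free_mod) (s : seq N) : uniq s ->
  (forall x, x \notin s -> coef f x = 0) ->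
  free_lift f = \sum_(x <- s) coef f x *: phi x.
Proof.
move=> us sf; rewrite /free_lift; case: (cid _) => /= t tf.
have E (r r' : seq N) : uniq r -> uniq r' -> {subset r <= r'} ->
    (forall x, x \notin r -> coef f x = 0) ->
    \sum_(x <- r) coef f x *: phi x = \sum_(x <- r') coef f x *: phi x.
  move=> ur ur' sr rf; rewrite [RHS](bigID (mem r)) /= [X in _ + X]big1 ?addr0.
    rewrite -[RHS]big_filter; apply: perm_big; apply: uniq_perm => //.
      exact: filter_uniq.
    by move=> x; rewrite mem_filter; case: (boolP (x \in r)) => //= /sr ->.
  by move=> x xr; rewrite rf // scale0r.
rewrite (E (undup t) (undup (t ++ s))) ?undup_uniq //.
- by symmetry; apply: E; rewrite ?undup_uniq // => x xs; rewrite mem_undup mem_cat xs orbT.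
- by move=> x; rewrite !mem_undup mem_cat => ->.
- by move=> x; rewrite mem_undup; apply: tf.
Qed.

Fact free_lift_linear : linear free_lift.
Proof.
move=> a f g; have [s sf] := fin_suppP f; have [t tg] := fin_suppP g.
pose r := undup (s ++ t).
have ur : uniq r by exact: undup_uniq.
have rf x : x \notin r -> coef f x = 0.
  by rewrite mem_undup mem_cat negb_or => /andP[/sf].
have rg x : x \notin r -> coef g x = 0.
  by rewrite mem_undup mem_cat negb_or => /andP[_ /tg].
have vE x : coef (a *: f + g) x = a * coef f x + coef g x by [].
rewrite (free_liftE ur rf) (free_liftE ur rg) (free_liftE ur); last first.
  by move=> x xr; rewrite vE rf // rg // mulr0 addr0.
rewrite scaler_sumr -big_split; apply: eq_bigr => x _ /=.
by rewrite vE scalerDl scalerA.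
Qed.

HB.instance Definition _ :=
  GRing.isLinear.Build R free_mod M *:%R free_lift free_lift_linear.
End Lift.

Definition delta_fun (y : N) : N -> R^o := fun x => (x == y)%:R.
Fact delta_fun_fin (y : N) : delta_fun y \in fin_supp.
Proof.
apply/asboolP; exists [:: y] => x; rewrite mem_seq1 /delta_fun.
by move/negPf ->.
Qed.
Definition delta (y : N) : free_mod := Sub (delta_fun y) (delta_fun_fin y).

Lemma free_lift_delta (M : lmodType R) (phi : N -> M) y :
  free_lift phi (delta y) = phi y.
Proof.
rewrite (@free_liftE _ _ _ [:: y]) //.
  by rewrite big_seq1 /coef /= /delta_fun eqxx scale1r.
by move=> x; rewrite mem_seq1 /coef /= /delta_fun => /negPf ->.
Qed.

Lemma free_deltaE (f : free_mod) : f = free_lift delta f.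
Proof.
apply: val_inj; apply: funext => y; rewrite -[LHS]/(coef f y) -[RHS]/(coef _ y); have [s sf] := fin_suppP f.
rewrite (@free_liftE _ _ _ (undup s)) ?undup_uniq //; last first.
  by move=> x; rewrite mem_undup; apply: sf.
have vS (r : seq N) : coef (\sum_(x <- r) coef f x *: delta x) y
     = \sum_(x <- r) coef f x * (y == x)%:R.
  elim: r => [|x r IHr]; rewrite ?big_nil // !big_cons -IHr //.
rewrite vS; case: (boolP (y \in undup s)) => ys.
  rewrite (bigD1_seq y) ?undup_uniq //= eqxx mulr1 big1 ?addr0 // => x /negPf xy.
  by rewrite eq_sym xy mulr0.
rewrite big1_seq => [|x /= xs]; first by rewrite sf // -mem_undup.
case: eqVneq xs => [<-|_ _]; last by rewrite mulr0.
by rewrite (negPf ys).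
Qed.

Lemma free_projective : projective free_mod.
Proof.
move=> M M' p f psurj.
exists (free_lift (fun y => projT1 (cid (psurj (f (delta y)))))) => g.
have [s sg] := fin_suppP g.
have us := undup_uniq s.
have sg' x : x \notin undup s -> coef g x = 0 by rewrite mem_undup; apply: sg.
rewrite [in RHS](free_deltaE g).
set phi := fun y => _.
rewrite -[LHS]/(p (free_lift phi g)) (free_liftE phi us sg').
rewrite (free_liftE delta us sg') !linear_sum.
by apply: eq_bigr => x _; rewrite !linearZ /= /phi; case: (cid (psurj (f (delta x)))) => /= z ->.
Qed.

End FreeModule.

Definition kernel (R : pzRingType) (M N : lmodType R) (f : {linear M -> N}) :
  {pred M} := fun x => f x == 0.

Section Kernel.
Variables (R : pzRingType) (M N : lmodType R) (f : {linear M -> N}).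
Fact kernel_submod_closed : submod_closed (kernel f).
Proof.
split=> [|a x y /eqP fx /eqP fy]; rewrite unfold_in /= ?linear0 //.
by rewrite linearP /= fx fy scaler0 addr0.
Qed.
HB.instance Definition _ :=
  GRing.isSubmodClosed.Build R M (kernel f) kernel_submod_closed.
End Kernel.

Section Resolution.
Variables (R : pzRingType) (N : lmodType R).

Definition free_eps (M : lmodType R) : {linear free_mod M -> M} :=
  free_lift (id : M -> M).

Fixpoint syzygy n : lmodType R :=
  if n is k.+1 then submod (kernel (free_eps (syzygy k))) else N.

Definition free_diff n : {linear free_mod (syzygy n.+1) -> free_mod (syzygy n)} :=
  (val : submod (kernel (free_eps (syzygy n))) -> _) \o free_eps (syzygy n.+1).

Lemma free_eps_surj (M : lmodType R) (y : M) : exists x, free_eps M x = y.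
Proof. by exists (delta y); rewrite /free_eps /= free_lift_delta. Qed.

Lemma free_exact n (x : free_mod (syzygy n)) :
  free_eps _ x = 0 <-> exists y, free_diff n y = x.
Proof.
split=> [x0|[y <-]]; last by apply/eqP; apply: (valP (free_eps (syzygy n.+1) y)).
have xK : x \in kernel (free_eps (syzygy n)) by apply/eqP.
have [y yE] := @free_eps_surj (syzygy n.+1) (Sub x xK).
by exists y; rewrite /free_diff /= -[LHS]/(val (free_eps _ y)) yE.
Qed.

Lemma free_exactS n (x : free_mod (syzygy n.+1)) :
  free_diff n x = 0 <-> exists y, free_diff n.+1 y = x.
Proof.
rewrite -free_exact; split=> [x0|x0]; first exact: val_inj.
by rewrite -[LHS]/(val (free_eps (syzygy n.+1) x)) x0.
Qed.

Definition free_resolution : proj_resolution N :=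
  @ProjResolution R N (fun n => free_mod (syzygy n)) free_diff (free_eps N)
    (fun n => @free_projective R _) (@free_eps_surj N) (@free_exact 0)
    free_exactS.
End Resolution.

(** * Bäckström pairs *)

Section Backstrom.
Variables (H : pzRingType) (A : subringClosed H).

Definition backstrom_pair : Prop :=
  [/\ semiperfect H, semiperfect (subring A) &
      forall x : H,
        x \in jacobson H <->
        exists2 a : subring A, a \in jacobson (subring A) & val a = x].

Definition conductor : {pred H^o} :=
  fun x => (x \in A) && `[< forall h : H, h * x \in A >].

Lemma conductorP (x : H) : reflect (forall h : H, h * x \in A) (x \in conductor).
Proof.
apply: (iffP andP) => [[_ /asboolP]//|Hx]; split; last exact/asboolP.
by rewrite -[x]mul1r.
Qed.

Fact conductor_submod_closed : submod_closed conductor.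
Proof.
split=> [|a x y /conductorP xC /conductorP yC]; apply/conductorP => h.
  by rewrite mulr0 rpred0.
by rewrite mulrDr rpredD //; have := xC (h * a); rewrite -mulrA.
Qed.

HB.instance Definition _ :=
  GRing.isSubmodClosed.Build H H^o conductor conductor_submod_closed.

Lemma conductor_sub (x : H) : x \in conductor -> x \in A.
Proof. by case/andP. Qed.

Lemma conductorMl (h x : H) : x \in conductor -> h * x \in conductor.
Proof. by move/conductorP=> xC; apply/conductorP => k; rewrite mulrA. Qed.

Lemma conductorMr (a x : H) : a \in A -> x \in conductor -> x * a \in conductor.
Proof.
by move=> aA /conductorP xC; apply/conductorP => k; rewrite mulrA rpredM.
Qed.

(* The matrix ring with rows (A, H) and (C, H), where C is the conductor *)
Definition auslander_pred : {pred 'M[H]_2} :=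
  fun X => (X 0 0 \in A) && (X 1 0 \in conductor).

Lemma big_ord2 (V : nmodType) (F : 'I_2 -> V) : \sum_i F i = F 0 + F 1.
Proof. by rewrite !big_ord_recl big_ord0 addr0; congr (F _ + F _); apply: val_inj. Qed.

Fact auslander_subring_closed : subring_closed auslander_pred.
Proof.
split=> [|X Y /andP[XA XC] /andP[YA YC]|X Y /andP[XA XC] /andP[YA YC]].
- by rewrite unfold_in !mxE /= rpred1 rpred0.
- rewrite unfold_in !mxE rpredB //=.
  by case: (submodClosedP conductor) => _ CD; rewrite addrC -mulN1r CD.
rewrite unfold_in !mxE !big_ord2; apply/andP; split.
  by apply: rpredD; [exact: rpredM | exact/conductor_sub/conductorMl].
by apply: rpredD; [exact: conductorMr | exact: conductorMl].
Qed.

HB.instance Definition _ :=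
  GRing.isSubringClosed.Build 'M[H]_2 auslander_pred auslander_subring_closed.

Definition auslander : Type := subring auslander_pred.
HB.instance Definition _ := GRing.PzRing.on auslander.
HB.instance Definition _ := SubChoice.on auslander.

Lemma auslander00 (X : auslander) : val X 0 0 \in A.
Proof. by case/andP: (valP X). Qed.

Lemma auslander10 (X : auslander) : val X 1 0 \in conductor.
Proof. by case/andP: (valP X). Qed.

(* The left ideal of matrices with rows (C, H) and (C, H) *)
Definition abar_ideal : {pred auslander^o} :=
  fun X => val X 0 0 \in conductor.

Fact abar_ideal_submod_closed : submod_closed abar_ideal.
Proof.
case: (submodClosedP conductor) => C0 CD; split=> [|X Y Z YC ZC].
  by rewrite unfold_in /= mxE.
rewrite unfold_in /= !mxE big_ord2 -addrA; apply: (CD) => //.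
by apply: (CD) => //; exact: auslander10.
Qed.

HB.instance Definition _ :=
  GRing.isSubmodClosed.Build auslander auslander^o abar_ideal
    abar_ideal_submod_closed.

(* \bar A, as the quotient of the Auslander envelope by that left ideal *)
Definition abar : lmodType auslander := quot_mod abar_ideal.

Definition ann_conductor (M : lmodType H) : {pred M} :=
  fun u => `[< forall c : H, c \in conductor -> c *: u = 0 >].

Fact ann_conductor_zmod_closed M : zmod_closed (@ann_conductor M).
Proof.
split=> [|u v /asboolP uC /asboolP vC]; apply/asboolP => c cC.
  by rewrite scaler0.
by rewrite scalerBr uC ?vC ?subr0.
Qed.

HB.instance Definition _ (M : lmodType H) :=
  GRing.isZmodClosed.Build M (@ann_conductor M) (ann_conductor_zmod_closed M).

End Backstrom.

Arguments conductor {H} A.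
Arguments ann_conductor {H} A M.

(* The module of columns M^+; the argument [A] only serves to select the ring
   acting on it *)
Definition colplus (H : pzRingType) (A : subringClosed H) (M : lmodType H) : Type :=
  'cV[M]_2.

Section ColPlus.
Variables (H : pzRingType) (A : subringClosed H) (M : lmodType H).
Local Notation colplus := (colplus A M).

HB.instance Definition _ := GRing.Zmodule.on colplus.

Definition colplus_scale (X : auslander A) (v : colplus) : colplus :=
  \col_i \sum_k val X i k *: v k 0.

Fact colplus_scaleA X Y v :
  colplus_scale X (colplus_scale Y v) = colplus_scale (X * Y) v.
Proof.
apply/matrixP => i j; rewrite !mxE !big_ord2 !mxE !big_ord2 !scalerDr !scalerDl.
by rewrite !scalerA addrACA.
Qed.
Fact colplus_scale1 : left_id 1 colplus_scale.
Proof.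
move=> v; apply/matrixP => i j; rewrite ord1 !mxE (bigD1 i) //= big1 => [|k ki].
  by rewrite mxE eqxx scale1r addr0.
by rewrite mxE eq_sym (negPf ki) scale0r.
Qed.
Fact colplus_scaleDr : right_distributive colplus_scale +%R.
Proof.
move=> X v w; apply/matrixP => i j; rewrite !mxE -big_split /=.
by apply: eq_bigr => k _; rewrite mxE scalerDr.
Qed.
Fact colplus_scaleDl v : {morph colplus_scale^~ v : X Y / X + Y}.
Proof.
move=> X Y; apply/matrixP => i j; rewrite !mxE -big_split /=.
by apply: eq_bigr => k _; rewrite mxE scalerDl.
Qed.

HB.instance Definition _ := GRing.Zmodule_isLmodule.Build (auslander A) colplus
  colplus_scaleA colplus_scale1 colplus_scaleDr colplus_scaleDl.

End ColPlus.

(* Main.v *)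
Require Import Defs.
From HB Require Import structures.
From mathcomp Require Import all_boot all_algebra.
From mathcomp Require Import boolp.

Set Implicit Arguments.
Unset Strict Implicit.
Unset Printing Implicit Defensive.

Import GRing.Theory.
Local Open Scope ring_scope.
Local Open Scope quotient_scope.

(** Write B for the Auslander envelope.  The left ideal I of B with rows (C, H)
    and (C, H) gives an exact sequence 0 -> I -> B -> \bar A -> 0 in which B is
    free.  As Ext^1(B, -) = 0, the long exact sequence of Hom(-, M^+) says that
    Hom(\bar A, M^+) is the set of v in Hom(B, M^+) = M^+ killed by I, and
    Ext^1(\bar A, M^+) is the cokernel of the restriction map
    Hom(B, M^+) -> Hom(I, M^+).

    The rest is matrix computation.  The ideal I is the direct sum of its first
    column, with entries in C, and of the projective column B e_22.

    - A vector (u, w) of M^+ is killed by I if and only if C u = 0 and w = 0,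
      which gives the first isomorphism (Hom_abar).

    - A B-linear map from the column with entries in C to M^+ commutes with the
      idempotents of B, so it acts separately on the two entries; it commutes
      with the matrix unit e_12, so it acts by the same map C -> M on both.  This
      map is H-linear because B contains all h e_22.  On the other summand
      B e_22 of I every map is multiplication by a vector, so it extends to B.
      Hence every map I -> M^+ is, up to restrictions from B, given entrywise by
      some f in Hom_H(C, M) (col_hom_decomp), and that entrywise map is the
      restriction of a map B -> M^+ exactly when f is some mu_u (col_hom_restr).
      Thus Ext^1(\bar A, M^+) is the cokernel of mu (Ext1_abar).

    The dimension shift for Ext^1 is done for an arbitrary projective resolution
    of \bar A, by comparing it with the sequence above (Ext1_quot). *)

(** * Factorization of additive and linear maps *)

Lemma additive_factor (U V W : zmodType) (p : {additive U -> V})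
    (f : {additive U -> W}) :
  (forall y, exists x, p x = y) -> (forall x, p x = 0 -> f x = 0) ->
  exists g : {additive V -> W}, forall x, g (p x) = f x.
Proof.
move=> p_surj ker_pf; pose s y := projT1 (cid (p_surj y)).
have sK y : p (s y) = y by rewrite /s; case: cid.
have fE x x' : p x = p x' -> f x = f x'.
  by move=> px; apply/subr0_eq; rewrite -raddfB ker_pf // raddfB px subrr.
have gZ : zmod_morphism (f \o s).
  by move=> y z /=; rewrite -raddfB; apply: fE; rewrite raddfB !sK.
pose gM := GRing.isZmodMorphism.Build V W (f \o s) gZ.
pose g : {additive V -> W} := HB.pack (f \o s) gM.
by exists g => x; apply: fE; rewrite sK.
Qed.

(** V and W are both the quotient of U by the same subgroup.  Both isomorphisms
    of the theorem arise this way, with no explicit inverse. *)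
Lemma zmod_iso_same_kernel (U V W : zmodType) (p : {additive U -> V})
    (q : {additive U -> W}) :
  (forall y, exists x, p x = y) -> (forall z, exists x, q x = z) ->
  (forall x, p x = 0 <-> q x = 0) -> zmod_iso V W.
Proof.
move=> p_surj q_surj kerE.
have [f fE] := additive_factor p_surj (fun x => (kerE x).1).
have [g gE] := additive_factor q_surj (fun x => (kerE x).2).
exists f; exists g => [y|z]; first by have [x <-] := p_surj y; rewrite fE gE.
by have [x <-] := q_surj z; rewrite gE fE.
Qed.

Definition zquot_proj (V : zmodType) (S : zmodClosed V) :
  {additive V -> Quotient.quot S} := \pi_(Quotient.quot S).

Lemma zquot_proj_surj (V : zmodType) (S : zmodClosed V) y :
  exists x, zquot_proj S x = y.
Proof. by exists (repr y); rewrite /= reprK. Qed.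

Lemma zquot_proj_eq0 (V : zmodType) (S : zmodClosed V) x :
  zquot_proj S x = 0 <-> x \in S.
Proof.
by rewrite -(raddf0 (zquot_proj S)) (rwP eqP) -Quotient.idealrBE subr0.
Qed.

Lemma linear_factor (R : pzRingType) (L N K : lmodType R) (p : {linear L -> N})
    (f : {linear L -> K}) :
  (forall y, exists x, p x = y) -> (forall x, p x = 0 -> f x = 0) ->
  exists g : {linear N -> K}, forall x, g (p x) = f x.
Proof.
move=> p_surj ker_pf; have [g gE] := additive_factor p_surj ker_pf.
have gZ : scalable g.
  move=> a y; have [x <-] := p_surj y; rewrite -linearZ_LR !gE.
  exact: linearZ_LR.
pose gM := GRing.isScalable.Build R N K *:%R g gZ.
pose h : {linear N -> K} := HB.pack (GRing.Additive.sort g) g gM.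
by exists h.
Qed.

Definition submod_val (R : pzRingType) (N : lmodType R) (S : submodClosed N) :
  {linear submod S -> N} := val.

Lemma submod_valP (R : pzRingType) (N : lmodType R) (S : submodClosed N)
    (x : submod S) :
  submod_val S x \in S.
Proof. exact: valP. Qed.

Lemma linear_corestr (R : pzRingType) (L N : lmodType R) (S : submodClosed N)
    (f : {linear L -> N}) :
  (forall x, f x \in S) ->
  exists g : {linear L -> submod S}, forall x, val (g x) = f x.
Proof.
move=> fS; pose g x : submod S := Sub (f x) (fS x).
have gL : linear g by move=> a x y; apply: val_inj; rewrite /= linearP.
pose gM := GRing.isLinear.Build R L (submod S) *:%R g gL.
by exists (HB.pack g gM : {linear L -> submod S}).
Qed.

Section Orbit.
Variables (R : pzRingType) (L : lmodType R) (v : L).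

Definition orbit_map (a : R^o) : L := (a : R) *: v.

Fact orbit_map_linear : linear orbit_map.
Proof. by move=> a b c; rewrite /orbit_map scalerDl scalerA. Qed.

HB.instance Definition _ :=
  GRing.isLinear.Build R R^o L *:%R orbit_map orbit_map_linear.

End Orbit.

Lemma regularE (R : pzRingType) (N : lmodType R) (f : {linear R^o -> N}) a :
  f a = (a : R) *: f 1.
Proof. by rewrite -linearZ_LR; congr (f _); rewrite -[RHS]/(a * 1) mulr1. Qed.

Lemma regular_projective (R : pzRingType) : projective R^o.
Proof.
move=> L N p f p_surj; have [x xE] := p_surj (f 1).
by exists (orbit_map x) => a; rewrite [LHS]linearZ_LR [RHS]regularE xE.
Qed.

Lemma quot_proj_eq0 (R : pzRingType) (Q : lmodType R) (T : submodClosed Q) x :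
  quot_proj T x = 0 <-> x \in T.
Proof. by rewrite -(raddf0 (quot_proj T)) (rwP eqP) quot_projE subr0. Qed.

(** * Linear maps from a cyclic module *)

Section CyclicModule.
Variables (R : pzRingType) (S : submodClosed R^o) (N : lmodType R).
Implicit Type phi : {linear quot_mod S -> N}.

Definition unit_class : quot_mod S := quot_proj S 1.

Lemma cyclic_homE phi a : phi (quot_proj S a) = (a : R) *: phi unit_class.
Proof. exact: (regularE (phi \o quot_proj S)). Qed.

Lemma cyclic_hom_killed phi a : a \in S -> (a : R) *: phi unit_class = 0.
Proof. by move=> /quot_proj_eq0 aS; rewrite -cyclic_homE aS raddf0. Qed.

Lemma cyclic_hom_exists v : (forall a, a \in S -> (a : R) *: v = 0) ->
  exists phi, phi unit_class = v.
Proof.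
move=> Sv.
have [|phi phiE] :=
  @linear_factor _ _ _ _ (quot_proj S) (orbit_map v) (@quot_projP _ _ S).
  by move=> a /quot_proj_eq0; exact: Sv.
by exists phi; rewrite phiE /= /orbit_map scale1r.
Qed.

Lemma cyclic_hom_eq0 phi : phi unit_class = 0 -> phi = 0.
Proof.
move=> phi1; apply: linear_ext => x; have [a <-] := quot_projP x.
by rewrite cyclic_homE phi1 scaler0.
Qed.

End CyclicModule.

(** * Dimension shift for Ext^1 *)

Section Ext1.
Variables (R : pzRingType) (Q : lmodType R) (S : submodClosed Q).
Variables (M : lmodType R) (P : proj_resolution (quot_mod S)).

(** Exactness of P_2 -> P_1 -> P_0 -> N identifies P_1 / im P_2 with the kernel
    of the augmentation P_0 -> N, so a 1-cocycle is the same thing as a map from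
    that kernel to M. *)
Lemma cocycle_factor (f : {linear res_obj P 1 -> M}) :
  f \in @cocycle R _ P M 1 ->
  exists F : {linear submod (kernel (res_aug P)) -> M},
    forall k y, val k = res_diff P 0 y -> F k = f y.
Proof.
move/asboolP=> fd.
have dK y : res_diff P 0 y \in kernel (res_aug P).
  by apply/eqP; apply/res_exact0; exists y.
have [d dE] := linear_corestr dK.
have [k|y dy0|F FE] := @linear_factor _ _ _ _ d f.
- have /eqP/res_exact0[y yE] := valP k.
  by exists y; apply: val_inj; rewrite dE yE.
- have /res_exactS[z <-] : res_diff P 0 y = 0 by rewrite -dE dy0.
  exact: fd.
exists F => k y kE; rewrite -FE; congr (F _).
by apply: val_inj; rewrite dE.
Qed.

(** The connecting map Hom(S, M) -> Ext^1(Q/S, M), with surjectivity and kernel.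
    Lifting the identity of Q/S gives maps p : P_0 -> Q and s : Q -> P_0 over
    Q/S, and Phi is the pullback along the map q : P_1 -> S induced by p.  The
    composites p s and s p need not be identities, but p s - 1 takes values in S
    and s p - 1 takes values in the kernel of the augmentation; these two error
    terms are the homotopies that make Phi surjective and compute its kernel. *)
Lemma Ext1_quot : projective Q ->
  exists Phi : {additive {linear submod S -> M} -> Ext_res P M 1},
    (forall y, exists phi, Phi phi = y) /\
    (forall phi, Phi phi = 0 <->
       exists psi : {linear Q -> M}, forall i, phi i = psi (val i)).
Proof.
move=> Q_proj.
have pi_quot_surj : forall y, exists x, quot_proj S x = y := @quot_projP _ _ S.
have [p pE] := @res_projective _ _ P 0 _ _ (quot_proj S) (res_aug P) pi_quot_surj.
have [s sE] := Q_proj _ _ (res_aug P) (quot_proj S) (@res_aug_surj _ _ P).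
have quot0 x : quot_proj S x = 0 <-> x \in S := quot_proj_eq0 S x.
have pdS y : (p \o res_diff P 0) y \in S.
  by apply/quot0; rewrite pE; apply/res_exact0; exists y.
have [q qE] := linear_corestr pdS.
have psS x : ((p \o s) \- idfun) x \in S.
  by apply/quot0; rewrite /= raddfB /= pE sE subrr.
have [t tE] := linear_corestr psS.
have spK x : ((s \o p) \- idfun) x \in kernel (res_aug P).
  by apply/eqP; rewrite /= raddfB /= sE pE subrr.
have [u uE] := linear_corestr spK.
have siK (i : submod S) : (s \o val) i \in kernel (res_aug P).
  by apply/eqP; rewrite /= sE; apply/quot0; exact: (valP i).
have [w wE] := linear_corestr siK.
have qZ (phi : {linear submod S -> M}) :
    (phi \o q : {linear _ -> _}) \in @cocycle R _ P M 1.
  apply/asboolP => y /=; rewrite (_ : q _ = 0) ?raddf0 //.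
  apply: val_inj; rewrite qE /= (_ : res_diff P 0 _ = 0) ?raddf0 //.
  by apply/res_exactS; exists y.
pose Phi0 (phi : {linear submod S -> M}) : Ext_res P M 1 :=
  zquot_proj (@coboundary _ _ P M 1) (Sub (phi \o q : {linear _ -> _}) (qZ phi)).
have Phi0Z : zmod_morphism Phi0.
  move=> phi psi; rewrite /Phi0 -raddfB; congr (zquot_proj _ _).
  by apply: val_inj; apply: linear_ext.
pose PhiM := GRing.isZmodMorphism.Build _ _ Phi0 Phi0Z.
exists (HB.pack Phi0 PhiM : {additive _ -> _}); split=> [y|phi].
  have [[f fZ] <-] := zquot_proj_surj y.
  (* f is the image of F \o s restricted to S, up to the coboundary of F applied
     to the error term s p - 1. *)
  have [F FE] := cocycle_factor fZ.
  exists (F \o w : {linear submod S -> M}); apply/subr0_eq.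
  rewrite /= /Phi0 -raddfB; apply/zquot_proj_eq0.
  apply/asboolP; exists (F \o u) => x /=.
  have /eqP/res_exact0[z zE] := valP (w (q x)).
  have -> : F (w (q x)) = f z by apply: FE.
  rewrite -raddfB; symmetry; apply: FE.
  rewrite uE /= raddfB; congr (_ - _).
  by transitivity (val (w (q x))); [rewrite wE /= qE | rewrite -zE].
rewrite /= /Phi0; rewrite zquot_proj_eq0; split=> [/asboolP[g gE]|[psi psiE]].
  (* For i in S we have i = p (s i) - t i, and phi \o p agrees with g on the
     kernel of the augmentation, which contains s i. *)
  exists ((g \o s) \- (phi \o t)) => i /=.
  have /eqP/res_exact0[z zE] := valP (w i).
  rewrite wE /= in zE; rewrite -zE -gE /= -raddfB; congr (phi _).
  by apply: val_inj; rewrite raddfB /= qE tE /= zE opprB addrC subrK.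
by apply/asboolP; exists (psi \o p) => y /=; rewrite psiE qE.
Qed.

End Ext1.

(** * The ideal with quotient \bar A, and the columns with entries in M *)

Lemma ord2_ind (T : 'I_2 -> Prop) : T 0 -> T 1 -> forall i, T i.
Proof.
move=> T0 T1 [[|[|//]] lt_i].
  by rewrite (_ : Ordinal _ = 0) //; apply: val_inj.
by rewrite (_ : Ordinal _ = 1) //; apply: val_inj.
Qed.

Section Auslander.
Variables (H : pzRingType) (A : subringClosed H) (M : lmodType H).
Local Notation C := (conductor A).
Local Notation Mplus := (colplus A M).

Definition bar_ideal : submodClosed (auslander A)^o := @abar_ideal H A.
Definition ideal_mod : lmodType (auslander A) := submod bar_ideal.

Lemma abarE : abar A = quot_mod bar_ideal.
Proof. by unfold abar, bar_ideal, reverse_coercion. Qed.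

Lemma colplus_scaleE (X : auslander A) (v : Mplus) i :
  (X *: v) i 0 = val X i 0 *: v 0 0 + val X i 1 *: v 1 0.
Proof. by rewrite mxE big_ord2. Qed.

Lemma colplus_ext (v w : Mplus) : v 0 0 = w 0 0 -> v 1 0 = w 1 0 -> v = w.
Proof.
by move=> e0 e1; apply/matrixP => i j; rewrite ord1; move: i; apply: ord2_ind.
Qed.

Definition conductor_elt (x : H) (xC : x \in C) : submod C := Sub x xC.

Definition ideal_elt (X : auslander A) (XI : X \in bar_ideal) : ideal_mod :=
  Sub X XI.

Definition ideal_val : {linear ideal_mod -> (auslander A)^o} :=
  submod_val bar_ideal.

Lemma ideal_valP X : ideal_val X \in bar_ideal.
Proof. exact: (@submod_valP _ _ bar_ideal). Qed.

Fact col0_conductor (X : ideal_mod) i : val (ideal_val X) i 0 \in C.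
Proof. by move: i; apply: ord2_ind; [exact: (valP X) | exact: auslander10]. Qed.

Definition col0 (X : ideal_mod) i : submod C :=
  conductor_elt (col0_conductor X i).

(** The second column of X is sent to 0: this is the extension by 0 to the whole
    ideal of the map that f induces on the column with entries in C. *)
Definition col_hom (f : {linear submod C -> M}) (X : ideal_mod) : Mplus :=
  \col_i f (col0 X i).

Fact col_hom_linear f : linear (col_hom f).
Proof.
move=> X Y Z; apply/matrixP => i j; rewrite ord1 [RHS]mxE colplus_scaleE !mxE.
rewrite -!linearZ_LR -!raddfD; congr (f _); apply: val_inj => /=.
by rewrite !mxE big_ord2.
Qed.

HB.instance Definition _ (f : {linear submod C -> M}) :=
  GRing.isLinear.Build (auslander A) ideal_mod Mplus *:%R (col_hom f)
    (col_hom_linear f).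

Lemma col_homB f g X : col_hom (f - g) X = col_hom f X - col_hom g X.
Proof. by apply/matrixP => i j; rewrite !mxE. Qed.

Definition zero_corner_mx (b c d : H) : 'M[H]_2 :=
  \matrix_(i, j) if i == 0 then if j == 0 then 0 else b
                 else if j == 0 then c else d.

Fact zero_corner_auslander b c d :
  c \in C -> zero_corner_mx b c d \in auslander_pred A.
Proof. by move=> cC; rewrite unfold_in !mxE /= rpred0. Qed.

Definition zero_corner b c d (cC : c \in C) : auslander A :=
  Sub (zero_corner_mx b c d) (zero_corner_auslander b d cC).

Fact zero_corner_ideal b c d (cC : c \in C) : zero_corner b d cC \in bar_ideal.
Proof. by rewrite unfold_in /= mxE rpred0. Qed.

Definition right_col (b d : H) : auslander A := zero_corner b d (rpred0 C).

Definition unit22 : ideal_mod := ideal_elt (zero_corner_ideal 0 1 (rpred0 C)).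

Definition lower_left (c : submod C) : ideal_mod :=
  ideal_elt (zero_corner_ideal 0 0 (valP c)).

Lemma ideal_valD X Y i j :
  val (ideal_val (X + Y)) i j = val (ideal_val X) i j + val (ideal_val Y) i j.
Proof. by rewrite /= mxE. Qed.

Lemma ideal_valZ (X : auslander A) Y i j :
  val (ideal_val (X *: Y)) i j =
    val X i 0 * val (ideal_val Y) 0 j + val X i 1 * val (ideal_val Y) 1 j.
Proof. by rewrite /= mxE big_ord2. Qed.

Lemma ideal_ext X Y :
  (forall i j, val (ideal_val X) i j = val (ideal_val Y) i j) -> X = Y.
Proof. by move=> XY; apply: val_inj; apply: val_inj; apply/matrixP. Qed.

(** The first column of X is moved to the lower left corner before a linear map
    is applied: left multiplication by the matrix units e_12 and e_22 brings it
    back, so a linear map is determined by its values on lower left corners and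
    on e_22. *)
Lemma ideal_decomp (X : ideal_mod) :
  X = right_col 1 0 *: lower_left (col0 X 0)
      + right_col 0 1 *: lower_left (col0 X 1)
      + (ideal_val X : auslander A) *: unit22.
Proof.
apply: ideal_ext => i j; rewrite !ideal_valD !ideal_valZ !mxE.
move: i j; do 2!apply: ord2_ind => /=;
by rewrite ?(mulr0, mul0r, mulr1, mul1r, addr0, add0r).
Qed.

Lemma lower_left_linear h c c' :
  lower_left (h *: c + c') = right_col 0 h *: lower_left c + lower_left c'.
Proof.
apply: ideal_ext => i j; rewrite ideal_valD ideal_valZ !mxE.
move: i j; do 2!apply: ord2_ind => /=;
by rewrite ?(mulr0, mul0r, mulr1, mul1r, addr0, add0r).
Qed.

(** Here v is the image of e_22, and f reads off the second entry of phi on the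
    lower left corner, where H acts through the elements h e_22. *)
Lemma col_hom_decomp (phi : {linear ideal_mod -> Mplus}) :
  exists (f : {linear submod C -> M}) v,
    forall X, phi X = col_hom f X + (ideal_val X : auslander A) *: v.
Proof.
have phiD X Y : phi (X + Y) = phi X + phi Y by exact: raddfD.
have phiZ a X : phi (a *: X) = a *: phi X by exact: linearZ_LR.
pose f (c : submod C) : M := phi (lower_left c) 1 0.
have fL : linear f.
  move=> h c c'; rewrite /f lower_left_linear phiD phiZ mxE colplus_scaleE.
  by rewrite !mxE /= scale0r add0r.
pose fM := GRing.isLinear.Build H (submod C) M *:%R f fL.
exists (HB.pack f fM : {linear _ -> _}), (phi unit22) => X.
rewrite {1}[X]ideal_decomp !phiD !phiZ; congr (_ + _).
apply: colplus_ext; rewrite [LHS]mxE [RHS]mxE !colplus_scaleE !mxE /= /f.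
  by rewrite !(scale0r, scale1r, addr0, add0r).
by rewrite !(scale0r, scale1r, addr0, add0r).
Qed.

Definition upper (u : M) : Mplus := \col_i if i == 0 then u else 0.

Lemma scale_upperE X u i : (X *: upper u) i 0 = val X i 0 *: u.
Proof. by rewrite colplus_scaleE !mxE /= scaler0 addr0. Qed.

(** A map defined on the whole ring is multiplication by a vector of columns; on
    lower left corners only its first entry u contributes.  Conversely
    multiplication by (u, 0) ignores second columns, as col_hom does. *)
Lemma col_hom_restr (f : {linear submod C -> M}) :
  (exists psi : {linear (auslander A)^o -> Mplus},
     forall X, col_hom f X = psi (ideal_val X)) <->
  exists u : M, forall c, f c = (val c : H) *: u.
Proof.
split=> [[psi psiE]|[u uE]].
  exists (psi 1 0 0) => c.
  have := congr1 (fun v : Mplus => v 1 0) (psiE (lower_left c)).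
  rewrite regularE colplus_scaleE !mxE /= scale0r addr0 => <-.
  by congr (f _); apply: val_inj; rewrite /= mxE.
exists (orbit_map (upper u)) => X; apply/matrixP => i j.
by rewrite ord1 scale_upperE mxE uE.
Qed.

(** Applying e_22 to v isolates its second entry, which must therefore vanish;
    the lower left corners c then impose c *: u = 0 on the first entry u. *)
Lemma killed_by_ideal (v : Mplus) :
  (forall X, X \in bar_ideal -> (X : auslander A) *: v = 0) <->
  v 1 0 = 0 /\ v 0 0 \in ann_conductor A M.
Proof.
split=> [Iv|[v1 /asboolP v0] X XI].
  split.
    have /(congr1 (fun w : Mplus => w 1 0)) := Iv _ (ideal_valP unit22).
    by rewrite colplus_scaleE !mxE /= scale0r add0r scale1r.
  apply/asboolP => c cC; pose k : submod C := conductor_elt cC.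
  have /(congr1 (fun w : Mplus => w 1 0)) := Iv _ (ideal_valP (lower_left k)).
  by rewrite colplus_scaleE !mxE /= scale0r addr0.
apply/matrixP => i j; rewrite ord1 colplus_scaleE v1 scaler0 addr0 mxE.
apply: v0; exact: (col0_conductor (ideal_elt XI)).
Qed.

(** * Hom and Ext^1 from \bar A to the columns *)

Lemma Hom_abar :
  zmod_iso {linear quot_mod bar_ideal -> Mplus} (sub_zmod (ann_conductor A M)).
Proof.
pose one : quot_mod bar_ideal := unit_class bar_ideal.
have phi1 (phi : {linear quot_mod bar_ideal -> Mplus}) :
    phi one 1 0 = 0 /\ phi one 0 0 \in ann_conductor A M.
  by apply/killed_by_ideal => X; exact: cyclic_hom_killed.
pose top (phi : {linear quot_mod bar_ideal -> Mplus}) :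
  sub_zmod (ann_conductor A M) := Sub (phi one 0 0) (phi1 phi).2.
have topZ : zmod_morphism top.
  by move=> phi psi; apply: val_inj; rewrite /= !mxE.
pose topM := GRing.isZmodMorphism.Build _ _ top topZ.
pose t : {additive {linear quot_mod bar_ideal -> Mplus} -> _} := HB.pack top topM.
apply: (@zmod_iso_same_kernel _ _ _ idfun t) => [phi|u|phi]; first by exists phi.
  have [X XI|phi phiE] := @cyclic_hom_exists _ bar_ideal _ (upper (val u)).
    apply: (killed_by_ideal _).2 XI; rewrite !mxE; split=> //.
    exact: (valP u).
  by exists phi; apply: val_inj; rewrite /= phiE mxE.
split=> [phi0|/(congr1 val) /= top0].
  by rewrite (phi0 : phi = 0) raddf0.
apply: cyclic_hom_eq0; apply: colplus_ext; rewrite mxE.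
  exact: top0.
exact: (phi1 phi).1.
Qed.

Lemma Ext1_abar (P : proj_resolution (quot_mod bar_ideal)) :
  exists2 Psi : {additive {linear submod C -> M} -> Ext_res P Mplus 1},
    (forall y, exists f, Psi f = y) &
    forall f, Psi f = 0 <-> exists u : M, forall c, f c = (val c : H) *: u.
Proof.
have [Phi [Phi_surj PhiE]] :=
  @Ext1_quot _ _ bar_ideal Mplus P (@regular_projective (auslander A)).
pose T (f : {linear submod C -> M}) : {linear ideal_mod -> Mplus} := col_hom f.
have TB : {morph T : f g / f - g}.
  by move=> f g; apply: linear_ext; exact: col_homB.
pose Psi f := Phi (T f).
have PsiZ : zmod_morphism Psi by move=> f g; rewrite /Psi TB raddfB.
pose PsiM := GRing.isZmodMorphism.Build _ _ Psi PsiZ.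
exists (HB.pack Psi PsiM : {additive _ -> _}) => [y|f].
  have [phi <-] := Phi_surj y; have [f [v phiE]] := col_hom_decomp phi.
  exists f; apply/esym/subr0_eq; rewrite /= /Psi -raddfB; apply/PhiE.
  exists (orbit_map v) => X.
  by rewrite -[LHS]/(phi X - col_hom f X) phiE addrC addKr.
rewrite /= /Psi PhiE; exact: col_hom_restr.
Qed.

End Auslander.

Section Multiplication.
Variables (H : pzRingType) (A : subringClosed H) (M : lmodType H).
Local Notation C := (conductor A).

Definition conductor_mult (u : M) : {linear submod C -> M} :=
  orbit_map u \o submod_val C.

Fact conductor_mult_zmod_morphism : zmod_morphism conductor_mult.
Proof. by move=> u v; apply: linear_ext => c; rewrite /= /orbit_map scalerBr. Qed.

HB.instance Definition _ := GRing.isZmodMorphism.Build M {linear submod C -> M}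
  conductor_mult conductor_mult_zmod_morphism.

Lemma conductor_mult_eq0 u : conductor_mult u = 0 <-> u \in ann_conductor A M.
Proof.
split=> [u0|/asboolP uC]; last by apply: linear_ext => c; exact: uC (valP c).
apply/asboolP => c cC.
by have := congr1 (fun f : {linear submod C -> M} => f (Sub c cC)) u0.
Qed.

End Multiplication.

Theorem theorem5p2 (H : pzRingType) (A : subringClosed H) (M : lmodType H)
    (hpair : backstrom_pair A)
    (hnoeth : left_noetherian (subring A))
    (hhered : left_hereditary H)
    (hfg : finitely_generated (restr_scalars (subring_val A) H^o)) :
  zmod_iso {linear abar A -> colplus A M} (sub_zmod (ann_conductor A M)) /\
  exists mu : {additive Quotient.quot (ann_conductor A M) ->
                        {linear submod (conductor A) -> M}},
    [/\ forall (u : M) (c : submod (conductor A)),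
          mu (\pi_(Quotient.quot (ann_conductor A M)) u) c = (val c : H) *: u,
        injective mu
      & forall P : proj_resolution (abar A),
          zmod_iso (Ext_res P (colplus A M) 1%N) (coker mu)].
Proof.
rewrite abarE; split; first exact: Hom_abar.
pose q := zquot_proj (ann_conductor A M).
have q_surj := @zquot_proj_surj _ (ann_conductor A M).
have qE u : q u = 0 <-> conductor_mult A u = 0.
  by rewrite zquot_proj_eq0 conductor_mult_eq0.
have [mu muE] := additive_factor (f := @conductor_mult _ A M) q_surj
  (fun u => (qE u).1).
exists mu; split=> [u c|x y|P].
- by rewrite [mu _]muE.
- have [[u <-] [v <-]] := (q_surj x, q_surj y).
  rewrite !muE => uv; apply/subr0_eq; rewrite -raddfB.
  by apply/qE; rewrite raddfB uv subrr.
have [Psi Psi_surj PsiE] := Ext1_abar M P.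
apply: (@zmod_iso_same_kernel _ _ _ Psi (zquot_proj (additive_image mu))) => //.
  exact: zquot_proj_surj.
move=> f; rewrite PsiE zquot_proj_eq0; split=> [[u uE]|/asboolP[x <-]].
  by apply/asboolP; exists (q u); rewrite muE; apply: linear_ext => c; rewrite uE.
by have [u <-] := q_surj x; exists u => c; rewrite muE.
Qed.
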